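(* Let $\mathcal{C}$ be a distributive Markov category. Any two coinflips in $\mathcal{C}$ coincide. In particular, if $\mathcal{D}$ is another distributive Markov category, any Markov functor $F:\mathcal{C}\to\mathcal{D}$ which preserves finite coproducts also preserves the coinflip: if $f:I\to I+I$ is a coinflip in $\mathcal{C}$, then $I\cong F(I)\xrightarrow{F(f)}F(I+I)\cong I+I$ is the coinflip in $\mathcal{D}$.
   Context: A Markov category is a symmetric monoidal category $(\mathcal{C},\otimes,I)$ in which every object $X$ is equipped with a commutative comonoid structure $(\mathrm{copy}_X: X\to X\otimes X,\ \mathrm{del}_X : X\to I)$ with $\mathrm{del}_{X\otimes Y}=\mathrm{del}_X\otimes \mathrm{del}_Y$ and $\mathrm{copy}_{X\otimes Y}=(X\otimes \sigma_{X,Y}\otimes Y)(\mathrm{copy}_X\otimes \mathrm{copy}_Y)$ ($\sigma$ the symmetry), and with $\mathrm{del}$ natural. Structural isomorphisms are suppressed. A morphism $f:X\to Y$ is deterministic if $\mathrm{copy}_Y f=(f\otimes f)\mathrm{copy}_X$; the deterministic morphisms form a Cartesian monoidal subcategory $\mathcal{C}_{\mathrm{det}}$. A Markov functor is a strong symmetric monoidal functor $F$ such that $F(X)\xrightarrow{F(\mathrm{copy}_X)}F(X\otimes X)\cong F(X)\otimes F(X)$ equals $\mathrm{copy}_{F(X)}$. A Markov category $\mathcal{C}$ is distributive if $\mathcal{C}_{\mathrm{det}}$ admits finite coproducts and these are preserved by the inclusion $\mathcal{C}_{\mathrm{det}}\hookrightarrow\mathcal{C}$ and by the tensors $A\otimes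 -$. A coinflip in a Markov category with finite coproducts is a morphism $f:I\to I+I$ such that (symmetry) $\tau_{I,I}f=f$, where $\tau_{A,B}:A+B\to B+A$ is the canonical isomorphism, and (interchange) $(f+f)f=(I+\tau_{I,I}+I)(f+f)f$ as morphisms $I\to I+I+I+I$. *)

(* Defs.v *)
From Stdlib Require Import ssreflect ProofIrrelevance.

Set Implicit Arguments.
Unset Strict Implicit.
Unset Printing Implicit Defensive.

Declare Scope cat_scope.
Delimit Scope cat_scope with cat.
Open Scope cat_scope.

Record Category := {
  ob :> Type;
  Hom : ob -> ob -> Type;
  idm : forall X, Hom X X;
  comp : forall X Y Z, Hom Y Z -> Hom X Y -> Hom X Z;
  comp_idl : forall X Y (f : Hom X Y), comp (idm Y) f = f;
  comp_idr : forall X Y (f : Hom X Y), comp f (idm X) = f;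
  comp_assoc : forall W X Y Z (h : Hom Y Z) (g : Hom X Y) (f : Hom W X),
    comp h (comp g f) = comp (comp h g) f
}.
Arguments Hom {c} X Y.
Arguments idm {c} X.
Arguments comp {c X Y Z} g f.

Notation "X ~> Y" := (Hom X Y) (at level 90, no associativity) : cat_scope.
Notation "g ∘ f" := (comp g f) (at level 40, left associativity) : cat_scope.

Record Iso (C : Category) (X Y : C) := {
  iso_fwd :> X ~> Y;
  iso_bwd : Y ~> X;
  iso_bwd_fwd : iso_bwd ∘ iso_fwd = idm X;
  iso_fwd_bwd : iso_fwd ∘ iso_bwd = idm Y
}.

Notation "i ^~1" := (iso_bwd i) (at level 2, left associativity, format "i ^~1")
  : cat_scope.

Record Functor (C D : Category) := {
  fob :> C -> D;
  fmap : forall X Y, (X ~> Y) -> (fob X ~> fob Y);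
  fmap_id : forall X, fmap (idm X) = idm (fob X);
  fmap_comp : forall X Y Z (g : Y ~> Z) (f : X ~> Y),
    fmap (g ∘ f) = fmap g ∘ fmap f
}.
Arguments fmap {C D} F {X Y} f : rename.

Record IsInitial (C : Category) (Z : C) := {
  from_initial : forall X, Z ~> X;
  from_initial_unique : forall X (f g : Z ~> X), f = g
}.

Record IsCoproduct (C : Category) (X Y P : C) (i1 : X ~> P) (i2 : Y ~> P) := {
  cocase : forall Z, (X ~> Z) -> (Y ~> Z) -> (P ~> Z);
  cocase_inl : forall Z (f : X ~> Z) (g : Y ~> Z), cocase f g ∘ i1 = f;
  cocase_inr : forall Z (f : X ~> Z) (g : Y ~> Z), cocase f g ∘ i2 = g;
  cocase_unique : forall Z (h k : P ~> Z),
    h ∘ i1 = k ∘ i1 -> h ∘ i2 = k ∘ i2 -> h = k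
}.
Arguments cocase {C X Y P i1 i2} i {Z} f g : rename.

Record FiniteCoproducts (C : Category) := {
  zero : C;
  zero_initial : IsInitial zero;
  coprod : C -> C -> C;
  coinl : forall X Y, X ~> coprod X Y;
  coinr : forall X Y, Y ~> coprod X Y;
  coprod_is : forall X Y, IsCoproduct (coinl X Y) (coinr X Y)
}.
Arguments coinl {C} S X Y : rename.
Arguments coinr {C} S X Y : rename.
Arguments coprod_is {C} S X Y : rename.

(** Initial objects are sent to initial objects and coproduct cocones to
    coproduct cocones; this makes no reference to chosen coproducts. *)
Record PreservesFiniteCoproducts (C D : Category) (F : Functor C D) := {
  pres_initial : forall Z : C, IsInitial Z -> IsInitial (F Z);
  pres_coproduct : forall (X Y P : C) (i1 : X ~> P) (i2 : Y ~> P),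
    IsCoproduct i1 i2 -> IsCoproduct (fmap F i1) (fmap F i2)
}.

Section CoproductOperations.
Context {C : Category} (S : FiniteCoproducts C).
Local Notation "X + Y" := (coprod S X Y) : cat_scope.

Definition copair {X Y Z : C} (f : X ~> Z) (g : Y ~> Z) : X + Y ~> Z :=
  cocase (coprod_is S X Y) f g.

Definition comap {X Y X' Y' : C} (f : X ~> X') (g : Y ~> Y') :
    X + Y ~> X' + Y' :=
  copair (coinl S X' Y' ∘ f) (coinr S X' Y' ∘ g).

Definition coswap (X Y : C) : X + Y ~> Y + X :=
  copair (coinr S Y X) (coinl S Y X).

Definition coassoc (X Y Z : C) : (X + Y) + Z ~> X + (Y + Z) :=
  copair (copair (coinl S X (Y + Z)) (coinr S X (Y + Z) ∘ coinl S Y Z))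
         (coinr S X (Y + Z) ∘ coinr S Y Z).

Definition coassoc_inv (X Y Z : C) : X + (Y + Z) ~> (X + Y) + Z :=
  copair (coinl S (X + Y) Z ∘ coinl S X Y)
         (copair (coinl S (X + Y) Z ∘ coinr S X Y) (coinr S (X + Y) Z)).

(** [W + τ_{X,Y} + Z], bracketed as a map [(W + X) + (Y + Z) ~> (W + Y) + (X + Z)]. *)
Definition comiddle (W X Y Z : C) : (W + X) + (Y + Z) ~> (W + Y) + (X + Z) :=
  coassoc_inv W Y (X + Z)
  ∘ comap (idm W) (coassoc Y X Z ∘ comap (coswap X Y) (idm Z) ∘ coassoc_inv X Y Z)
  ∘ coassoc W X (Y + Z).

End CoproductOperations.

Record SymMonCategory := {
  smc_cat :> Category;
  tunit : smc_cat;
  tens : smc_cat -> smc_cat -> smc_cat;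
  tmap : forall X Y X' Y' : smc_cat,
    (X ~> X') -> (Y ~> Y') -> (tens X Y ~> tens X' Y');
  assoc : forall X Y Z, Iso (tens (tens X Y) Z) (tens X (tens Y Z));
  lunit : forall X, Iso (tens tunit X) X;
  runit : forall X, Iso (tens X tunit) X;
  braid : forall X Y, tens X Y ~> tens Y X;
  tmap_id : forall X Y, tmap (idm X) (idm Y) = idm (tens X Y);
  tmap_comp : forall X Y X' Y' X'' Y''
    (f' : X' ~> X'') (f : X ~> X') (g' : Y' ~> Y'') (g : Y ~> Y'),
    tmap (f' ∘ f) (g' ∘ g) = tmap f' g' ∘ tmap f g;
  assoc_natural : forall X Y Z X' Y' Z' (f : X ~> X') (g : Y ~> Y') (h : Z ~> Z'),
    assoc X' Y' Z' ∘ tmap (tmap f g) h = tmap f (tmap g h) ∘ assoc X Y Z;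
  lunit_natural : forall X X' (f : X ~> X'),
    lunit X' ∘ tmap (idm tunit) f = f ∘ lunit X;
  runit_natural : forall X X' (f : X ~> X'),
    runit X' ∘ tmap f (idm tunit) = f ∘ runit X;
  braid_natural : forall X Y X' Y' (f : X ~> X') (g : Y ~> Y'),
    braid X' Y' ∘ tmap f g = tmap g f ∘ braid X Y;
  pentagon : forall W X Y Z,
    tmap (idm W) (assoc X Y Z) ∘ assoc W (tens X Y) Z ∘ tmap (assoc W X Y) (idm Z)
    = assoc W X (tens Y Z) ∘ assoc (tens W X) Y Z;
  triangle : forall X Y,
    tmap (idm X) (lunit Y) ∘ assoc X tunit Y = tmap (runit X) (idm Y);
  hexagon : forall X Y Z,
    assoc Y Z X ∘ braid X (tens Y Z) ∘ assoc X Y Z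
    = tmap (idm Y) (braid X Z) ∘ assoc Y X Z ∘ tmap (braid X Y) (idm Z);
  braid_invol : forall X Y, braid Y X ∘ braid X Y = idm (tens X Y)
}.
Arguments tunit {s}.
Arguments tens {s} X Y.
Arguments tmap {s X Y X' Y'} f g.
Arguments assoc {s} X Y Z.
Arguments lunit {s} X.
Arguments runit {s} X.
Arguments braid {s} X Y.

Notation "X ⊗ Y" := (tens X Y) (at level 38, left associativity) : cat_scope.
Notation "f ⊠ g" := (tmap f g) (at level 38, left associativity) : cat_scope.

(** [W ⊗ σ_{X,Y} ⊗ Z], bracketed as a map [(W ⊗ X) ⊗ (Y ⊗ Z) ~> (W ⊗ Y) ⊗ (X ⊗ Z)]. *)
Definition middle (C : SymMonCategory) (W X Y Z : C) :
    (W ⊗ X) ⊗ (Y ⊗ Z) ~> (W ⊗ Y) ⊗ (X ⊗ Z) :=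
  (assoc W Y (X ⊗ Z))^~1
  ∘ (idm W ⊠ (assoc Y X Z ∘ (braid X Y ⊠ idm Z) ∘ (assoc X Y Z)^~1))
  ∘ assoc W X (Y ⊗ Z).

Record MarkovCategory := {
  mc_smc :> SymMonCategory;
  copy : forall X : mc_smc, X ~> X ⊗ X;
  del : forall X : mc_smc, X ~> tunit;
  copy_coassoc : forall X,
    assoc X X X ∘ (copy X ⊠ idm X) ∘ copy X = (idm X ⊠ copy X) ∘ copy X;
  copy_counitl : forall X, lunit X ∘ (del X ⊠ idm X) ∘ copy X = idm X;
  copy_counitr : forall X, runit X ∘ (idm X ⊠ del X) ∘ copy X = idm X;
  copy_comm : forall X, braid X X ∘ copy X = copy X;
  copy_tens : forall X Y, copy (X ⊗ Y) = middle X X Y Y ∘ (copy X ⊠ copy Y);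
  del_tens : forall X Y, del (X ⊗ Y) = lunit tunit ∘ (del X ⊠ del Y);
  del_natural : forall X Y (f : X ~> Y), del Y ∘ f = del X
}.
Arguments copy {m} X.
Arguments del {m} X.

Definition deterministic (C : MarkovCategory) (X Y : C) (f : X ~> Y) : Prop :=
  copy Y ∘ f = (f ⊠ f) ∘ copy X.

Lemma deterministic_id (C : MarkovCategory) (X : C) : deterministic (idm X).
Proof. by rewrite /deterministic tmap_id comp_idl comp_idr. Qed.

Lemma deterministic_comp (C : MarkovCategory) (X Y Z : C)
    (g : Y ~> Z) (f : X ~> Y) :
  deterministic g -> deterministic f -> deterministic (g ∘ f).
Proof.
move=> dg df; rewrite /deterministic comp_assoc dg -comp_assoc df.
by rewrite comp_assoc -tmap_comp.
Qed.

Lemma assoc_bwd_natural (C : SymMonCategory) (X Y Z X' Y' Z' : C)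
    (f : X ~> X') (g : Y ~> Y') (h : Z ~> Z') :
  (assoc X' Y' Z')^~1 ∘ (f ⊠ (g ⊠ h)) = ((f ⊠ g) ⊠ h) ∘ (assoc X Y Z)^~1.
Proof.
rewrite -[LHS]comp_idr -(iso_fwd_bwd (assoc X Y Z)) comp_assoc.
rewrite -(comp_assoc _ (f ⊠ _)) -assoc_natural comp_assoc.
by rewrite iso_bwd_fwd comp_idl.
Qed.

Lemma middle_natural (C : SymMonCategory) (W X Y Z W' X' Y' Z' : C)
    (a : W ~> W') (b : X ~> X') (c : Y ~> Y') (d : Z ~> Z') :
  middle W' X' Y' Z' ∘ ((a ⊠ b) ⊠ (c ⊠ d))
  = ((a ⊠ c) ⊠ (b ⊠ d)) ∘ middle W X Y Z.
Proof.
set t := (assoc Y X Z ∘ (braid X Y ⊠ idm Z)) ∘ (assoc X Y Z)^~1.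
set t' := (assoc Y' X' Z' ∘ (braid X' Y' ⊠ idm Z')) ∘ (assoc X' Y' Z')^~1.
have t_natural : t' ∘ (b ⊠ (c ⊠ d)) = (c ⊠ (b ⊠ d)) ∘ t.
  rewrite /t /t' -comp_assoc assoc_bwd_natural -[in LHS]comp_assoc.
  rewrite [X in _ ∘ X]comp_assoc -tmap_comp braid_natural comp_idl.
  by rewrite -(comp_idr d) tmap_comp !comp_assoc assoc_natural comp_idr.
rewrite /middle -/t -/t' -comp_assoc assoc_natural -comp_assoc.
rewrite [X in _ ∘ X]comp_assoc -tmap_comp t_natural comp_idl.
by rewrite -(comp_idr a) tmap_comp !comp_assoc assoc_bwd_natural comp_idr.
Qed.

Lemma deterministic_tmap (C : MarkovCategory) (X Y X' Y' : C)
    (f : X ~> X') (g : Y ~> Y') :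
  deterministic f -> deterministic g -> deterministic (f ⊠ g).
Proof.
move=> df dg; rewrite /deterministic !copy_tens -comp_assoc -tmap_comp df dg.
by rewrite tmap_comp comp_assoc middle_natural comp_assoc.
Qed.

Section DeterministicSubcategory.
Variable C : MarkovCategory.

Definition det_hom (X Y : C) : Type := {f : X ~> Y | deterministic f}.

Lemma det_hom_eq (X Y : C) (f g : det_hom X Y) :
  proj1_sig f = proj1_sig g -> f = g.
Proof. by apply: eq_sig_hprop => x; apply: proof_irrelevance. Qed.

Definition det_id (X : C) : det_hom X X := exist _ (idm X) (deterministic_id X).

Definition det_comp (X Y Z : C) (g : det_hom Y Z) (f : det_hom X Y) :
    det_hom X Z :=
  exist _ (proj1_sig g ∘ proj1_sig f)
    (deterministic_comp (proj2_sig g) (proj2_sig f)).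

Definition det : Category.
Proof.
refine (@Build_Category C det_hom det_id det_comp _ _ _) => *;
  apply: det_hom_eq; [exact: comp_idl | exact: comp_idr | exact: comp_assoc].
Defined.

Definition det_incl : Functor det C :=
  @Build_Functor det C (fun X => X) (fun X Y f => proj1_sig f)
    (fun X => eq_refl) (fun X Y Z g f => eq_refl).

Definition det_tensor_map (A : C) (X Y : det) (f : @Hom det X Y) :
    @Hom det (A ⊗ X) (A ⊗ Y) :=
  exist _ (idm A ⊠ proj1_sig f)
    (deterministic_tmap (deterministic_id A) (proj2_sig f)).

Definition det_tensor (A : C) : Functor det det.
Proof.
refine (@Build_Functor det det (fun X => A ⊗ X) (@det_tensor_map A) _ _) => *;
  apply: det_hom_eq => /=.
- exact: tmap_id.
- by rewrite -tmap_comp comp_idl.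
Defined.

End DeterministicSubcategory.

Record Distributive (C : MarkovCategory) := {
  det_coproducts : FiniteCoproducts (det C);
  incl_preserves : PreservesFiniteCoproducts (det_incl C);
  tensor_preserves : forall A : C, PreservesFiniteCoproducts (det_tensor A)
}.

(** Since the inclusion preserves finite coproducts, the coproducts of [det C]
    are coproducts of [C]. *)
Definition dist_coproducts (C : MarkovCategory) (hC : Distributive C) :
    FiniteCoproducts C :=
  let S := det_coproducts hC in
  @Build_FiniteCoproducts C (zero S)
    (pres_initial (incl_preserves hC) (zero_initial S))
    (coprod S)
    (fun X Y => proj1_sig (coinl S X Y))
    (fun X Y => proj1_sig (coinr S X Y))
    (fun X Y => pres_coproduct (incl_preserves hC) (coprod_is S X Y)).

Definition coinflip (C : MarkovCategory) (S : FiniteCoproducts C)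
    (f : tunit ~> coprod S tunit tunit) : Prop :=
  let I := @tunit C in
  coswap S I I ∘ f = f /\
  comap S f f ∘ f = comiddle S I I I I ∘ (comap S f f ∘ f).

Arguments coinflip {C} S f.

Record MarkovFunctor (C D : MarkovCategory) := {
  mf_functor :> Functor C D;
  mf_unit : Iso tunit (mf_functor tunit);
  mf_tens : forall X Y, Iso (mf_functor X ⊗ mf_functor Y) (mf_functor (X ⊗ Y));
  mf_tens_natural : forall X Y X' Y' (f : X ~> X') (g : Y ~> Y'),
    mf_tens X' Y' ∘ (fmap mf_functor f ⊠ fmap mf_functor g)
    = fmap mf_functor (f ⊠ g) ∘ mf_tens X Y;
  mf_assoc : forall X Y Z,
    fmap mf_functor (assoc X Y Z) ∘ mf_tens (X ⊗ Y) Z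
      ∘ (mf_tens X Y ⊠ idm (mf_functor Z))
    = mf_tens X (Y ⊗ Z) ∘ (idm (mf_functor X) ⊠ mf_tens Y Z)
      ∘ assoc (mf_functor X) (mf_functor Y) (mf_functor Z);
  mf_lunit : forall X,
    fmap mf_functor (lunit X) ∘ mf_tens tunit X ∘ (mf_unit ⊠ idm (mf_functor X))
    = lunit (mf_functor X);
  mf_runit : forall X,
    fmap mf_functor (runit X) ∘ mf_tens X tunit ∘ (idm (mf_functor X) ⊠ mf_unit)
    = runit (mf_functor X);
  mf_braid : forall X Y,
    fmap mf_functor (braid X Y) ∘ mf_tens X Y
    = mf_tens Y X ∘ braid (mf_functor X) (mf_functor Y);
  mf_copy : forall X,
    (mf_tens X X)^~1 ∘ fmap mf_functor (copy X) = copy (mf_functor X)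
}.
Arguments mf_unit {C D} F : rename.

(** The canonical isomorphism [F (X + Y) ≅ F X + F Y]; its inverse is the usual
    comparison map. *)
Definition coprod_comparison (C D : Category) (F : Functor C D)
    (pF : PreservesFiniteCoproducts F)
    (S : FiniteCoproducts C) (T : FiniteCoproducts D) (X Y : C) :
    Iso (F (coprod S X Y)) (coprod T (F X) (F Y)).
Proof.
refine {|
  iso_fwd := cocase (pres_coproduct pF (coprod_is S X Y))
               (coinl T (F X) (F Y)) (coinr T (F X) (F Y));
  iso_bwd := copair T (fmap F (coinl S X Y)) (fmap F (coinr S X Y))
|}.
- apply: (cocase_unique (pres_coproduct pF (coprod_is S X Y)));
    by rewrite -comp_assoc ?cocase_inl ?cocase_inr comp_idl /copair
               ?cocase_inl ?cocase_inr.
- apply: (cocase_unique (coprod_is T (F X) (F Y)));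
    by rewrite -comp_assoc /copair ?cocase_inl ?cocase_inr comp_idl
               ?cocase_inl ?cocase_inr.
Defined.

(** [I ≅ F I -> F (I + I) ≅ F I + F I ≅ I + I]. *)
Definition transport_flip (C D : MarkovCategory) (F : MarkovFunctor C D)
    (pF : PreservesFiniteCoproducts F)
    (S : FiniteCoproducts C) (T : FiniteCoproducts D)
    (f : (tunit : C) ~> coprod S tunit tunit) :
    (tunit : D) ~> coprod T tunit tunit :=
  comap T (mf_unit F)^~1 (mf_unit F)^~1
  ∘ coprod_comparison pF S T tunit tunit
  ∘ fmap F f
  ∘ mf_unit F.
Arguments transport_flip {C D} F pF S T f.

(* Main.v *)
From Stdlib Require Import ssreflect.
Require Import Defs.

Set Implicit Arguments.
Unset Strict Implicit.
Unset Printing Implicit Defensive.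

(** Read a map [f : I ~> I + I] as the binary operation
    [f(a, b) := [a, b] ∘ f] on the maps [a, b : I ~> X]. In these terms:

    - the operation is idempotent, [f(a, a) = a], because the unit object is
      terminal ([copair_flip_diag]);
    - the symmetry of a coinflip is commutativity, [f(a, b) = f(b, a)];
    - any two such operations commute with each other,
      [f(g(a, b), g(c, d)) = g(f(a, c), f(b, d))] ([flip_fubini]). This is where
      distributivity enters: [a, b, c, d] are the four components of a map out
      of [(I + I) ⊗ (I + I)], and both sides are its composite with [f ⊗ g],
      computed by performing [g] last or [f] last.

    An Eckmann-Hilton argument then gives uniqueness ([symmetric_flip_unique]):
    [g(a, b) = f(g(a, b), g(a, b)) = f(g(a, b), g(b, a))
     = g(f(a, b), f(b, a)) = g(f(a, b), f(a, b)) = f(a, b)].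

    Taking [g = f] in the commutation law yields the interchange axiom, so in a
    distributive Markov category a coinflip is the same thing as a symmetric map
    [I ~> I + I] ([symmetric_coinflip]). Preservation by functors therefore
    comes down to the naturality of the swap [τ] ([transport_flip_symmetric]). *)

(** * Coherence at the unit *)

Section UnitCoherence.
Variable C : SymMonCategory.
Local Notation I := (@tunit C).

Lemma iso_cancel_right (X Y Z : C) (i : Iso X Y) (h k : Y ~> Z) :
  h ∘ i = k ∘ i -> h = k.
Proof.
by move=> e; rewrite -(comp_idr h) -(comp_idr k) -(iso_fwd_bwd i) !comp_assoc e.
Qed.

Lemma iso_cancel_left (X Y Z : C) (i : Iso X Y) (h k : Z ~> X) :
  i ∘ h = i ∘ k -> h = k.
Proof.
by move=> e; rewrite -(comp_idl h) -(comp_idl k) -(iso_bwd_fwd i) -!comp_assoc e.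
Qed.

Lemma tmap_unit_left_inj (X Y : C) (h k : X ~> Y) :
  idm I ⊠ h = idm I ⊠ k -> h = k.
Proof.
by move=> e; apply: (iso_cancel_right (i := lunit X)); rewrite -!lunit_natural e.
Qed.

Lemma tmap_unit_right_inj (X Y : C) (h k : X ~> Y) :
  h ⊠ idm I = k ⊠ idm I -> h = k.
Proof.
by move=> e; apply: (iso_cancel_right (i := runit X)); rewrite -!runit_natural e.
Qed.

(** One of the redundant axioms in Mac Lane's original list: after tensoring
    with the unit on the left and precomposing with associators, both sides are
    instances of the triangle, related by the pentagon. *)
Lemma lunit_tens (X Y : C) : lunit (X ⊗ Y) ∘ assoc I X Y = lunit X ⊠ idm Y.
Proof.
apply: tmap_unit_left_inj.
apply: (iso_cancel_right (i := assoc I (I ⊗ X) Y)).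
have a_epi (Z : C) (h k : (I ⊗ (I ⊗ X)) ⊗ Y ~> Z) :
    h ∘ (assoc I I X ⊠ idm Y) = k ∘ (assoc I I X ⊠ idm Y) -> h = k.
  move=> e; rewrite -(comp_idr h) -(comp_idr k) -tmap_id -(comp_idl (idm Y)).
  by rewrite -(iso_fwd_bwd (assoc I I X)) tmap_comp !comp_assoc e.
apply: a_epi.
rewrite -{1}(comp_idl (idm I)) tmap_comp -!comp_assoc (comp_assoc (_ ⊠ assoc _ _ _)).
rewrite pentagon comp_assoc triangle -tmap_id -assoc_natural.
rewrite (comp_assoc _ (assoc _ _ _)) -assoc_natural -comp_assoc -tmap_comp.
by rewrite triangle comp_idl.
Qed.

(** Kelly's theorem: [λ_I ⊗ I] and [ρ_I ⊗ I] both equal [(I ⊗ λ_I) ∘ α]. *)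
Lemma lunit_runit_unit : iso_fwd (lunit I) = iso_fwd (runit I).
Proof.
apply: tmap_unit_right_inj; rewrite -triangle -lunit_tens; congr (_ ∘ _).
by apply: (iso_cancel_left (i := lunit I)); rewrite lunit_natural.
Qed.

End UnitCoherence.

(** The counit law makes [del I] a split epimorphism, and naturality makes it
    idempotent. *)
Lemma del_unit (C : MarkovCategory) : del (@tunit C) = idm tunit.
Proof.
have split : del (@tunit C) ∘ (runit tunit ∘ copy tunit) = idm tunit.
  by rewrite comp_assoc -runit_natural -lunit_runit_unit copy_counitl.
by rewrite -(comp_idr (del _)) -{1}split comp_assoc del_natural.
Qed.

(** Discarding is natural, so every map into [I] is a discarding map. *)
Lemma unit_terminal (C : MarkovCategory) (X : C) (h k : X ~> tunit) : h = k.
Proof. by rewrite -(comp_idl h) -(comp_idl k) -del_unit !del_natural. Qed.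

(** * Calculus of copairings *)

Section Copairing.
Variables (C : Category) (S : FiniteCoproducts C).

Lemma copair_inl (X Y Z : C) (f : X ~> Z) (g : Y ~> Z) :
  copair S f g ∘ coinl S X Y = f.
Proof. exact: cocase_inl. Qed.

Lemma copair_inr (X Y Z : C) (f : X ~> Z) (g : Y ~> Z) :
  copair S f g ∘ coinr S X Y = g.
Proof. exact: cocase_inr. Qed.

Lemma copair_unique (X Y Z : C) (f : X ~> Z) (g : Y ~> Z)
    (h : coprod S X Y ~> Z) :
  h ∘ coinl S X Y = f -> h ∘ coinr S X Y = g -> h = copair S f g.
Proof.
by move=> ef eg; apply: (cocase_unique (coprod_is S X Y));
  rewrite ?copair_inl ?copair_inr.
Qed.

Lemma comp_copair (X Y Z W : C) (k : Z ~> W) (f : X ~> Z) (g : Y ~> Z) :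
  k ∘ copair S f g = copair S (k ∘ f) (k ∘ g).
Proof. by apply: copair_unique; rewrite -comp_assoc ?copair_inl ?copair_inr. Qed.

Lemma copair_inj (X Y : C) : copair S (coinl S X Y) (coinr S X Y) = idm _.
Proof. by symmetry; apply: copair_unique; rewrite comp_idl. Qed.

Lemma copair_swap (X Y Z : C) (f : X ~> Z) (g : Y ~> Z) :
  copair S f g ∘ coswap S Y X = copair S g f.
Proof. by rewrite /coswap comp_copair copair_inl copair_inr. Qed.

Lemma copair_comap (X Y X' Y' Z : C) (a : X ~> X') (b : Y ~> Y')
    (f : X' ~> Z) (g : Y' ~> Z) :
  copair S f g ∘ comap S a b = copair S (f ∘ a) (g ∘ b).
Proof.
by rewrite /comap comp_copair !comp_assoc copair_inl copair_inr.
Qed.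

Lemma coswap_comap (X Y X' Y' : C) (a : X ~> X') (b : Y ~> Y') :
  coswap S X' Y' ∘ comap S a b = comap S b a ∘ coswap S X Y.
Proof. by rewrite /comap copair_swap copair_comap. Qed.

(** [W + τ + Z] transposes the four summands seen as a two by two table. *)
Lemma comiddle_copair (W X Y Z : C) :
  comiddle S W X Y Z
  = copair S
      (copair S (coinl S _ _ ∘ coinl S _ _) (coinr S _ _ ∘ coinl S _ _))
      (copair S (coinl S _ _ ∘ coinr S _ _) (coinr S _ _ ∘ coinr S _ _)).
Proof.
have inlK (A B V U : C) (f : A ~> V) (g : B ~> V) (k : U ~> A) :
    copair S f g ∘ (coinl S A B ∘ k) = f ∘ k by rewrite comp_assoc copair_inl.
have inrK (A B V U : C) (f : A ~> V) (g : B ~> V) (k : U ~> B) :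
    copair S f g ∘ (coinr S A B ∘ k) = g ∘ k by rewrite comp_assoc copair_inr.
pose beta := (copair_inl, copair_inr, inlK, inrK).
rewrite /comiddle /coassoc /coassoc_inv /coswap /comap.
rewrite -!comp_assoc !comp_copair -?comp_assoc ?beta ?comp_idr.
by rewrite ?comp_copair ?beta.
Qed.

End Copairing.

(** * Flips in a distributive Markov category *)

Section Flips.
Variables (C : MarkovCategory) (hC : Distributive C).
Local Notation S := (dist_coproducts hC).
Local Notation I := (@tunit C).
Local Notation inl := (coinl S I I).
Local Notation inr := (coinr S I I).
Local Notation "[ a , b ]" := (copair S a b) : cat_scope.

(** The tensor preserves coproducts among deterministic maps only; the inclusion
    then makes the resulting cocone a coproduct for all maps, which is needed to
    test equality of the random maps below. *)
Lemma tensor_coproduct (A X Y : C) :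
  IsCoproduct (idm A ⊠ coinl S X Y) (idm A ⊠ coinr S X Y).
Proof.
exact: (pres_coproduct (incl_preserves hC)
         (pres_coproduct (tensor_preserves hC A)
           (coprod_is (det_coproducts hC) X Y))).
Qed.

(** [a] is pulled out of the flip, leaving an endomap of the terminal [I]. *)
Lemma copair_flip_diag (X : C) (f : I ~> coprod S I I) (a : I ~> X) :
  [a, a] ∘ f = a.
Proof.
rewrite -{1 2}(comp_idr a) -comp_copair -comp_assoc -[RHS]comp_idr.
by congr (_ ∘ _); apply: unit_terminal.
Qed.

Lemma tmap_slide (X X' Y Y' : C) (f : X ~> X') (g : Y ~> Y') :
  (f ⊠ idm Y') ∘ (idm X ⊠ g) = (idm X' ⊠ g) ∘ (f ⊠ idm Y).
Proof. by rewrite -!tmap_comp !comp_idl !comp_idr. Qed.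

(** Independent flips may be performed in either order: both sides are
    [h ∘ (f ⊗ g)], up to a unit isomorphism, for one map [h] out of
    [(I + I) ⊗ (I + I)]. *)
Lemma flip_fubini (X : C) (f g : I ~> coprod S I I) (a b c d : I ~> X) :
  [[a, b] ∘ g, [c, d] ∘ g] ∘ f = [[a, c] ∘ f, [b, d] ∘ f] ∘ g.
Proof.
(* [h] is the map out of [(I + I) ⊗ (I + I)] with components [a, b, c, d]. *)
pose h := cocase (tensor_coproduct (coprod S I I) I I)
            ([a, c] ∘ runit _) ([b, d] ∘ runit _).
have h_inl : h ∘ (idm _ ⊠ inl) = [a, c] ∘ runit _ by exact: cocase_inl.
have h_inr : h ∘ (idm _ ⊠ inr) = [b, d] ∘ runit _ by exact: cocase_inr.
(* Fixing the first flip at [k] leaves a copairing on the second factor. *)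
have row (k : I ~> coprod S I I) :
    h ∘ (k ⊠ idm _) = [[a, c] ∘ k, [b, d] ∘ k] ∘ lunit _.
  apply: (cocase_unique (tensor_coproduct I I I));
    rewrite -!comp_assoc tmap_slide lunit_natural !comp_assoc
      ?h_inl ?h_inr ?copair_inl ?copair_inr -!comp_assoc runit_natural;
    by rewrite lunit_runit_unit.
have column : h ∘ (idm _ ⊠ g) = [[a, b] ∘ g, [c, d] ∘ g] ∘ runit _.
  have runit_bwd_natural (k : I ~> coprod S I I) :
      (runit _)^~1 ∘ k = (k ⊠ idm I) ∘ (runit I)^~1.
    apply: (iso_cancel_left (i := runit _)).
    by rewrite !comp_assoc iso_fwd_bwd runit_natural -comp_assoc iso_fwd_bwd
      comp_idl comp_idr.
  (* Distributivity in the form used here splits only the right factor, so the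
     coproduct structure of [(I + I) ⊗ I] is taken from [I + I] instead. *)
  have bwd : h ∘ (idm _ ⊠ g) ∘ (runit _)^~1 = [[a, b] ∘ g, [c, d] ∘ g].
    apply: copair_unique; rewrite -comp_assoc runit_bwd_natural comp_assoc
      -(comp_assoc h) -tmap_slide comp_assoc row -(comp_assoc _ (lunit _))
      lunit_natural lunit_runit_unit -!comp_assoc iso_fwd_bwd comp_idr
      ?copair_inl ?copair_inr //.
  by rewrite -bwd -comp_assoc iso_bwd_fwd comp_idr.
apply: (iso_cancel_right (i := runit I)).
rewrite -comp_assoc -runit_natural comp_assoc -column -comp_assoc -tmap_slide.
by rewrite comp_assoc row -comp_assoc lunit_natural lunit_runit_unit comp_assoc.
Qed.

(** Eckmann-Hilton for commutative idempotent operations. *)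
Lemma symmetric_flip_unique (f g : I ~> coprod S I I) :
  coswap S I I ∘ f = f -> coswap S I I ∘ g = g -> f = g.
Proof.
have id_flip (k : I ~> coprod S I I) : [inl, inr] ∘ k = k.
  by rewrite copair_inj comp_idl.
rewrite /coswap => sf sg.
(* At [a = d = inl] and [b = c = inr] symmetry makes both rows of the table,
   and both columns, equal. *)
have := flip_fubini f g inl inr inr inl.
by rewrite !id_flip sf sg !copair_flip_diag => ->.
Qed.

(** Interchange is the commutation of [f] with itself, applied to the four
    injections into [(I + I) + (I + I)]. *)
Lemma symmetric_coinflip (f : I ~> coprod S I I) :
  coswap S I I ∘ f = f -> coinflip S f.
Proof.
move=> sf; split=> //.
have split_copair (X : C) (k : coprod S I I ~> X) :
    k = [k ∘ inl, k ∘ inr] by exact: copair_unique.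
rewrite comp_assoc comiddle_copair copair_comap /comap flip_fubini.
by rewrite -!split_copair.
Qed.

End Flips.

(** * Transport along Markov functors *)

(** The comparison isomorphism commutes with swaps because both composites
    exchange the injections, and the unit isomorphism acts alike on the two
    summands. *)
Lemma transport_flip_symmetric (C D : MarkovCategory) (F : MarkovFunctor C D)
    (pF : PreservesFiniteCoproducts F)
    (S : FiniteCoproducts C) (T : FiniteCoproducts D)
    (f : (tunit : C) ~> coprod S tunit tunit) :
  coswap S tunit tunit ∘ f = f ->
  coswap T tunit tunit ∘ transport_flip F pF S T f = transport_flip F pF S T f.
Proof.
move=> sf.
have swap : coswap T _ _ ∘ coprod_comparison pF S T tunit tunit
    = coprod_comparison pF S T tunit tunit ∘ fmap F (coswap S tunit tunit).
  apply: (cocase_unique (pres_coproduct pF (coprod_is S tunit tunit)));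
    by rewrite -!comp_assoc -fmap_comp /coswap ?copair_inl ?copair_inr /=
      !cocase_inl !cocase_inr ?copair_inl ?copair_inr.
rewrite /transport_flip !comp_assoc coswap_comap -(comp_assoc _ (coswap _ _ _)).
by rewrite swap !comp_assoc -(comp_assoc _ (fmap F (coswap _ _ _))) -fmap_comp sf.
Qed.

Theorem proposition4p7 (C : MarkovCategory) (hC : Distributive C) :
  (forall f g : Hom tunit (coprod (dist_coproducts hC) tunit tunit),
     coinflip (dist_coproducts hC) f -> coinflip (dist_coproducts hC) g -> f = g)
  /\
  (forall (D : MarkovCategory) (hD : Distributive D)
          (F : MarkovFunctor C D) (pF : PreservesFiniteCoproducts F)
          (f : Hom tunit (coprod (dist_coproducts hC) tunit tunit)),
     coinflip (dist_coproducts hC) f ->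
     unique (coinflip (dist_coproducts hD))
       (transport_flip F pF (dist_coproducts hC) (dist_coproducts hD) f)).
Proof.
split=> [f g [sf _] [sg _] | D hD F pF f [sf _]].
  exact: symmetric_flip_unique.
have st := transport_flip_symmetric pF (dist_coproducts hD) sf.
split=> [|g [sg _]]; first exact: symmetric_coinflip.
exact: symmetric_flip_unique.
Qed.
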